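(* There exist absolute constants $c,c'>0$ such that the following is true. Let $n\ge1$, let $\Sigma$ be a finite set with $q=|\Sigma|$, let $b\ge1$, $\rho\in(0,1]$, let $\Delta\ge1$ be an integer, and let $\nu$ be a probability measure on $\Sigma^n$ such that: (1) $\nu(x)/\nu(y)\in[1/b,b]$ for all $x,y\in\Sigma^n$ at Hamming distance one; (2) the Glauber dynamics for $\nu$ satisfy the log-Sobolev inequality with constant $\rho$; (3) $\nu$ is a Markov random field with respect to a graph $G$ on $[n]$ of maximum degree $\Delta$. Then for every $f:\Sigma^n\to\mathbb{R}$ and every $T$ with $0<T\le c/(b^2q^2\Delta^2)$, $$\mathrm{Var}_\nu(f)\le\frac{c'q^2b^2}{1-e^{-\rho T}}\int_0^T\sum_{j=1}^n\|L_jf\|_{1+e^{-2\rho t}}^2\,dt.$$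
   Context: All norms are $L_p(\nu)$ norms: $\|f\|_p=(\mathbb{E}_\nu|f|^p)^{1/p}$. For $x\in\Sigma^n$, $x_{\sim i}$ denotes $x$ with coordinate $i$ removed. For $i\in[n]$, $(P_if)(x)=\mathbb{E}_{X\sim\nu}[f(X)\mid X_{\sim i}=x_{\sim i}]$ and $L_if=P_if-f$. The Dirichlet form of the (continuous-time) Glauber dynamics is $\mathcal{E}_\nu(f,f)=\sum_{i=1}^n\mathbb{E}_\nu[(L_if)^2]$. The Glauber dynamics for $\nu$ satisfy the log-Sobolev inequality with constant $\rho>0$ if $\rho\,\mathrm{Ent}_\nu[f]\le 2\mathcal{E}_\nu(\sqrt f,\sqrt f)$ for all $f:\Sigma^n\to\mathbb{R}_{\ge0}$, where $\mathrm{Ent}_\nu[f]=\mathbb{E}_\nu[f\log f]-\mathbb{E}_\nu[f]\log\mathbb{E}_\nu[f]$. $\nu$ is a Markov random field with respect to $G$ if for every vertex $i$ with neighbor set $\mathcal{N}(i)$ and $X\sim\nu$, $X_i$ is conditionally independent of all the other coordinates given $X_{\mathcal{N}(i)}$. *)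

(* Defs.v *)
From HB Require Import structures.
From mathcomp Require Import all_boot all_order all_algebra.
From mathcomp Require Import all_classical all_reals all_analysis.
Set Implicit Arguments.
Unset Strict Implicit.
Unset Printing Implicit Defensive.
Import Order.TTheory GRing.Theory Num.Theory.
Local Open Scope ring_scope.

Notation config n Sigma := {ffun 'I_n -> Sigma}.

Definition hamming (n : nat) (Sigma : finType) (x y : config n Sigma) : nat :=
  #|[set i | x i != y i]|.

(* The event X_S = x_S. *)
Definition agree (n : nat) (Sigma : finType) (S : {set 'I_n})
    (x : config n Sigma) : {set config n Sigma} :=
  [set y : config n Sigma | [forall i in S, y i == x i]].

Section FiniteProbability.
Variables (R : realType) (T : finType).
Implicit Types (nu f : T -> R) (A B : {set T}).

(* A probability measure on a finite type is given by its mass function. *)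
Definition is_prob nu : Prop := (forall x, 0 <= nu x) /\ \sum_x nu x = 1.

Definition Pr nu A : R := \sum_(x in A) nu x.

(* As usual in a field with x / 0 = 0, the two conditional quantities below are
   meaningful only if Pr nu B != 0. *)
Definition condPr nu A B : R := Pr nu (A :&: B) / Pr nu B.

Definition Ex nu f : R := \sum_x nu x * f x.

Definition condEx nu f B : R := (\sum_(x in B) nu x * f x) / Pr nu B.

Definition Var nu f : R := Ex nu (fun x => (f x - Ex nu f) ^+ 2).

(* ln 0 = 0 in the library, hence 0 log 0 = 0 here. *)
Definition Ent nu f : R :=
  Ex nu (fun x => f x * ln (f x)) - Ex nu f * ln (Ex nu f).

Definition norm_p nu (p : R) f : R :=
  (Ex nu (fun x => `|f x| `^ p)) `^ p^-1.

End FiniteProbability.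

Section Glauber.
Variables (R : realType) (n : nat) (Sigma : finType).
Implicit Types (nu f : config n Sigma -> R).

Definition Pop nu (i : 'I_n) f : config n Sigma -> R :=
  fun x => condEx nu f (agree [set~ i] x).

Definition Lop nu (i : 'I_n) f : config n Sigma -> R :=
  fun x => Pop nu i f x - f x.

Definition dirichlet nu f : R :=
  \sum_(i < n) Ex nu (fun x => (Lop nu i f x) ^+ 2).

Definition log_sobolev nu (rho : R) : Prop :=
  forall f, (forall x, 0 <= f x) ->
    rho * Ent nu f <= 2 * dirichlet nu (fun x => Num.sqrt (f x)).

(* X_A and X_B are conditionally independent given X_C. *)
Definition cond_indep nu (A B C : {set 'I_n}) : Prop :=
  forall x y z : config n Sigma, Pr nu (agree C z) != 0 ->
    condPr nu (agree A x :&: agree B y) (agree C z) =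
    condPr nu (agree A x) (agree C z) * condPr nu (agree B y) (agree C z).

Definition neighbors (e : rel 'I_n) (i : 'I_n) : {set 'I_n} :=
  [set j | e i j].

Definition max_degree (e : rel 'I_n) : nat :=
  (\max_(i < n) #|neighbors e i|)%N.

Definition markov_random_field nu (e : rel 'I_n) : Prop :=
  forall i : 'I_n, cond_indep nu [set i] [set~ i] (neighbors e i).

Definition bounded_ratios nu (b : R) : Prop :=
  forall x y : config n Sigma, hamming x y = 1%N ->
    b^-1 <= nu x / nu y <= b.

End Glauber.

(* Main.v *)
Require Import Defs.
From HB Require Import structures.
From mathcomp Require Import all_boot all_order all_algebra.
From mathcomp Require Import all_classical all_reals all_analysis.
From mathcomp Require Import ring lra.
Import Order.TTheory GRing.Theory Num.Theory.
Import numFieldNormedType.Exports.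
Set Implicit Arguments.
Unset Strict Implicit.
Unset Printing Implicit Defensive.
Local Open Scope classical_set_scope.
Local Open Scope ring_scope.

(** Let [P_t] be the heat semigroup generated by [sum_i L_i] and [D] the maximum
degree.  The log-Sobolev inequality gives the Poincare inequality, whence
[(1 - e^(-rho T)) Var f <= |f|_2^2 - |P_T f|_2^2], and (Gross) the hypercontractive
bound [|P_t g|_2 <= |g|_(1 + e^(-2 rho t))].  The dissipation
[G t = |f|_2^2 - |P_t f|_2^2] has derivative [2 sum_i |L_i P_t f|_2^2], so it
remains to exchange [L_i] and [P_t].  With [w_i = L_i P_t f], interpolate by
[s |-> sum_i <L_i P_s f, P_(t-s) w_i>]: the derivative only involves the
commutators of [L_i] and [L_j] for adjacent [i], [j], since the Markov property
makes the others vanish, and each [L_i] is an [L_2] contraction.  Hence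
[sum_i |L_i P_t f|_2^2 <= 2 sum_i |L_i f|_(1 + e^(-2 rho t))^2 + 4 D^2 T (G t)]
for [t <= T]; integrating over [[0, T]], the last term is absorbed by [G T] as soon
as [D T <= 1/4]. *)

(** * Calculus and exponentials of kernels *)

Section RealCalculus.
Variable R : realType.
Implicit Types (f df : R -> R) (a b s t : R).

Lemma is_derive_le0_nincr f df a b : a <= b ->
  (forall t, a <= t <= b -> is_derive t 1 f (df t)) ->
  (forall t, a <= t <= b -> df t <= 0) -> f b <= f a.
Proof.
move=> ab fdf df0.
have in_ab t : t \in `]a, b[%R -> a <= t <= b.
  by rewrite in_itv /= => /andP[at_ tb]; rewrite !ltW.
apply: (@ler0_derive1_nincr _ f a b) => //.
- by move=> t /in_ab tab; case: (fdf t tab).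
- move=> t /in_ab tab; rewrite derive1E; case: (fdf t tab) => _ ->; exact: df0.
- apply: derivable_within_continuous => t; rewrite in_itv /= => tab.
  by case: (fdf t tab).
Qed.

Lemma is_derive_continuous (F : R -> R) (d t : R) :
  is_derive t 1 F d -> {for t, continuous F}.
Proof.
by case=> dF _; apply: differentiable_continuous; exact/derivable1_diffP.
Qed.

Lemma is_derive_sum_fin (I : finType) (h : I -> R -> R) (dh : I -> R) t :
  (forall i, is_derive t 1 (h i) (dh i)) ->
  is_derive t 1 (fun s => \sum_i h i s) (\sum_i dh i).
Proof.
move=> hdh.
rewrite (_ : (fun s => _) =
  \sum_(i < #|I|) h (enum_val i)); last first.
  by apply/funext => s; rewrite fct_sumE [LHS](reindex _ (onW_bij _ (enum_val_bij I))).
by rewrite (reindex _ (onW_bij _ (enum_val_bij I)))/=; exact: is_derive_sum.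
Qed.

Lemma cvg_sum_fin (Z : Type) (F : set_system Z) (I : finType)
    (h : I -> Z -> R) (l : I -> R) : Filter F ->
  (forall i, h i @ F --> l i) -> (fun z => \sum_i h i z) @ F --> \sum_i l i.
Proof.
move=> FF hl; elim: (index_enum I) => [|i r IH].
  rewrite big_nil (eq_cvg _ _ (fun=> big_nil _ _ _ _)); exact: cvg_cst.
rewrite big_cons (eq_cvg _ _ (fun=> big_cons _ _ _ _ _ _)).
exact: cvgD (hl i) IH.
Qed.

End RealCalculus.

Section KernelExponential.
Variables (R : realType) (T : finType) (k : T -> T -> R).
Implicit Types (f g : T -> R) (x y : T) (t : R).

Definition kop f : T -> R := fun x => \sum_y k x y * f y.

(** Working at a fixed point [x] turns the series of [e^(t k) f] into a scalar power series in
    [t]. *)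
Definition kexp_coef f x (j : nat) : R := iter j kop f x / j`!%:R.

Definition kexp t f x : R := limn (pseries (kexp_coef f x) t).

Lemma pseries_diffs_kexp f x :
  pseries_diffs (kexp_coef f x) = kexp_coef (kop f) x.
Proof.
apply/funext => j; rewrite /pseries_diffs /kexp_coef -iterSr factS natrM invfM.
by rewrite mulrCA mulVKf.
Qed.

(** Each application of [k] multiplies the l1 norm by at most the sum of all [|k y z|]. This crude
    factor is enough for domination by an exponential series. *)
Lemma kexp_coef_bound f x (j : nat) :
  `|kexp_coef f x j| <=
    (\sum_y `|f y|) * ((\sum_y \sum_z `|k y z|) ^+ j / j`!%:R).
Proof.
rewrite normrM normfV normr_nat mulrA ler_wpM2r ?invr_ge0 ?ler0n//.
suff: \sum_y `|iter j kop f y| <=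
    (\sum_y `|f y|) * (\sum_y \sum_z `|k y z|) ^+ j.
  apply: le_trans; rewrite (bigD1 x)//= lerDl sumr_ge0 //.
elim: j => [|j IH]; first by rewrite expr0 mulr1.
rewrite exprS mulrCA.
apply: le_trans (ler_wpM2l _ IH); last first.
  by apply: sumr_ge0 => y _; apply: sumr_ge0.
rewrite mulr_suml; apply: ler_sum => y _ /=.
rewrite {1}/kop; apply: le_trans (ler_norm_sum _ _ _) _.
rewrite mulr_suml; apply: ler_sum => z _; rewrite normrM ler_wpM2l//.
by rewrite (bigD1 z)//= lerDl sumr_ge0.
Qed.

Lemma is_cvg_kexp f x t : cvgn (pseries (kexp_coef f x) t).
Proof.
apply: normed_cvg.
set M : R := \sum_y `|f y|; set C : R := \sum_y \sum_z `|k y z|.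
apply: (@series_le_cvg _ _ (fun j => M * exp_coeff (C * `|t|) j)).
- by move=> j; exact: normr_ge0.
- move=> j; rewrite mulr_ge0 ?sumr_ge0// exp_coeff_ge0// mulr_ge0// sumr_ge0// => y _.
  exact: sumr_ge0.
- move=> j; rewrite /= normrM normrX (le_trans (ler_wpM2r _ (kexp_coef_bound f x j)))//.
  by rewrite /exp_coeff /= exprMn -/M -/C mulrA mulrAC -!mulrA.
- rewrite [X in cvgn X](_ : _ = M *: series (exp_coeff (C * `|t|))).
    by apply: is_cvgZr; exact: is_cvg_series_exp_coeff.
  by apply/funext => m; rewrite /series /= -mulr_sumr.
Qed.

(** Termwise differentiation of the series produces [kexp t (kop f)]; moving [kop] outside turns
    this into the evolution equation. The finite sum over [y] passes through the limit. *)
Lemma kexp_kop t f x : kexp t (kop f) x = kop (kexp t f) x.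
Proof.
apply/cvg_lim => //.
rewrite [X in X @ _ --> _](_ : _ = fun m =>
   \sum_y k x y * pseries (kexp_coef f y) t m).
  by apply: cvg_sum_fin => y; apply: cvgMl_tmp; exact: is_cvg_kexp.
apply/funext => m; rewrite /pseries /series /=.
under [in RHS]eq_bigr do rewrite mulr_sumr.
rewrite exchange_big /=; apply: eq_bigr => j _.
rewrite /kexp_coef -iterSr /= {1}/kop !mulr_suml; apply: eq_bigr => y _.
by rewrite !mulrA.
Qed.

Lemma is_derive_kexp t f x :
  is_derive t 1 (fun s => kexp s f x) (kop (kexp t f) x).
Proof.
rewrite -kexp_kop /kexp -pseries_diffs_kexp.
(* [|t| + 1] is a point of convergence of modulus strictly larger than [|t|], as termwise
   differentiation requires. *)
apply: (@pseries_snd_diffs _ _ (`|t| + 1)); rewrite ?pseries_diffs_kexp;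
  try exact: is_cvg_kexp.
by rewrite [ltRHS]ger0_norm ?addr_ge0// ltrDl.
Qed.

Lemma kexp0 f x : kexp 0 f x = f x.
Proof.
apply/cvg_lim => //; apply: (@cvg_trans _ ((fun _ : nat => f x) @ \oo)).
  apply: near_eq_cvg; exists 1%N => // -[//|m] _ /=.
  rewrite /pseries /series /= big_nat_recl// expr0 mulr1 big1 ?addr0.
    by rewrite /kexp_coef /= fact0 divr1.
  by move=> j _; rewrite expr0n mulr0.
exact: cvg_cst.
Qed.

Lemma kexp_ge0 t f : (forall x y, 0 <= k x y) -> 0 <= t ->
  (forall x, 0 <= f x) -> forall x, 0 <= kexp t f x.
Proof.
move=> k0 t0 f0 x; apply: limr_ge; first exact: is_cvg_kexp.
near=> m; apply: sumr_ge0 => j _; rewrite mulr_ge0 ?exprn_ge0// divr_ge0//.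
elim: j x => [//|j IH] x; rewrite iterS; apply: sumr_ge0 => y _; exact: mulr_ge0.
Unshelve. all: by end_near. Qed.

End KernelExponential.

(** * Single-site operators *)

Section GlauberOperators.
Variables (R : realType) (n : nat) (Sigma : finType).
Notation T := (config n Sigma).
Variable nu : T -> R.
Hypothesis nu_gt0 : forall x, 0 < nu x.
Hypothesis nu_sum1 : \sum_x nu x = 1.
Implicit Types (f g h u : T -> R) (x y : T) (i j : 'I_n) (s t : R).

Lemma agree_refl (S : {set 'I_n}) x : x \in agree S x.
Proof. by rewrite inE; apply/forallP => i; rewrite eqxx implybT. Qed.

Lemma agree_eq (S : {set 'I_n}) x y : y \in agree S x -> agree S y = agree S x.
Proof.
rewrite inE => /forallP xy; apply/setP => z; rewrite !inE.
by apply: eq_forallb => i; case: (i \in S) (xy i) => //= /eqP ->.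
Qed.

Lemma agree_sym (S : {set 'I_n}) x y : (y \in agree S x) = (x \in agree S y).
Proof.
by rewrite !inE; apply: eq_forallb => i; rewrite [x i == _]eq_sym.
Qed.

Lemma Pr_agree_gt0 (S : {set 'I_n}) x : 0 < Pr nu (agree S x).
Proof.
rewrite /Pr (bigD1 x) ?agree_refl//= ltr_pwDl// sumr_ge0// => y _.
exact: ltW.
Qed.

(** The transition matrix of resampling coordinate [i], indexed by full configurations so that [P_i]
    becomes a [kop]. *)
Definition gker i x y : R :=
  (y \in agree [set~ i] x)%:R * nu y / Pr nu (agree [set~ i] x).

Lemma PopE i f : Pop nu i f = kop (gker i) f.
Proof.
apply/funext => x; rewrite /Pop /condEx /kop mulr_suml big_mkcond /=.
apply: eq_bigr => y _; rewrite /gker; case: ifP => _; last by rewrite !mul0r.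
by rewrite mul1r mulrAC.
Qed.

Lemma gker_ge0 i x y : 0 <= gker i x y.
Proof. by rewrite divr_ge0 ?mulr_ge0 ?ler0n// ltW// Pr_agree_gt0. Qed.

Lemma gker_sum1 i x : \sum_y gker i x y = 1.
Proof.
rewrite -mulr_suml -[RHS](divff (lt0r_neq0 (Pr_agree_gt0 [set~ i] x))).
congr (_ / _); rewrite /Pr [RHS]big_mkcond; apply: eq_bigr => y _.
by case: ifP; rewrite ?mul1r ?mul0r.
Qed.

(** Detailed balance: agreeing off [i] is an equivalence relation, so both sides carry the same
    normalizing mass. *)
Lemma gker_reversible i x y : nu x * gker i x y = nu y * gker i y x.
Proof.
rewrite /gker [x \in _]agree_sym; case: (boolP (y \in _)) => [/agree_eq ->|_].
  by rewrite !mul1r !mulrA [nu x * _]mulrC.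
by rewrite !mul0r !mulr0.
Qed.

Lemma Pop_idem i f : Pop nu i (Pop nu i f) = Pop nu i f.
Proof.
apply/funext => x; rewrite {1}/Pop /condEx.
rewrite (eq_bigr (fun y => nu y * Pop nu i f x)); last first.
  by move=> y /agree_eq xy; rewrite /Pop xy.
by rewrite -mulr_suml mulrAC divff ?mul1r// lt0r_neq0// Pr_agree_gt0.
Qed.

Definition dot f g : R := Ex nu (fun x => f x * g x).

Lemma dotC f g : dot f g = dot g f.
Proof. by apply: eq_bigr => x _; rewrite [f x * _]mulrC. Qed.

Lemma dotDr f g h : dot f (fun x => g x + h x) = dot f g + dot f h.
Proof. by rewrite /dot /Ex -big_split; apply: eq_bigr => x _ /=; ring. Qed.

Lemma dotBr f g h : dot f (fun x => g x - h x) = dot f g - dot f h.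
Proof. by rewrite /dot /Ex -sumrB; apply: eq_bigr => x _ /=; ring. Qed.

Lemma dotBl f g h : dot (fun x => g x - h x) f = dot g f - dot h f.
Proof. by rewrite dotC dotBr ![dot f _]dotC. Qed.

Lemma dotZr f g (a : R) : dot f (fun x => a * g x) = a * dot f g.
Proof. by rewrite /dot /Ex mulr_sumr; apply: eq_bigr => x _ /=; ring. Qed.

Lemma dot_sumr (I : finType) (P : pred I) f (F : I -> T -> R) :
  dot f (fun x => \sum_(k | P k) F k x) = \sum_(k | P k) dot f (F k).
Proof.
by rewrite exchange_big; apply: eq_bigr => x _ /=; rewrite -!mulr_sumr.
Qed.

Lemma dot_ge0 f : 0 <= dot f f.
Proof.
by apply: sumr_ge0 => x _; rewrite mulr_ge0 ?(ltW (nu_gt0 _))// -expr2 sqr_ge0.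
Qed.

Lemma dot_eq0 f : dot f f = 0 -> forall x, f x = 0.
Proof.
move=> /eqP; rewrite psumr_eq0; last first.
  by move=> x _; rewrite mulr_ge0 ?(ltW (nu_gt0 _))// -expr2 sqr_ge0.
move=> /allP f0 x; have := f0 x (mem_index_enum x).
by rewrite /= mulf_eq0 (gt_eqF (nu_gt0 x)) mulf_eq0 orbb => /eqP.
Qed.

Lemma Ex_cst (a : R) : Ex nu (fun=> a) = a.
Proof. by rewrite /Ex -mulr_suml nu_sum1 mul1r. Qed.

Lemma VarE f : Var nu f = dot f f - Ex nu f ^+ 2.
Proof.
rewrite /Var; set m := Ex nu f.
transitivity (\sum_x (nu x * (f x * f x) - 2 * m * (nu x * f x) + m ^+ 2 * nu x)).
  by apply: eq_bigr => x _; ring.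
rewrite big_split sumrB /= -!mulr_sumr nu_sum1 -/(Ex nu f) -/m.
by rewrite -/(Ex nu (fun x => f x * f x)) -/(dot f f); ring.
Qed.

Lemma young_dot f g (e : R) : 0 < e ->
  `|dot f g| <= e / 2 * dot f f + (2 * e)^-1 * dot g g.
Proof.
move=> e0; have sq (k x : R) : 0 <= (2 * e)^-1 * (e * k + x) ^+ 2.
  by rewrite mulr_ge0 ?sqr_ge0// invr_ge0 mulr_ge0// ltW.
rewrite ler_norml -subr_ge0 -[X in _ && X]subr_ge0 opprK.
rewrite /dot /Ex !mulr_sumr -!big_split -sumrB /=.
apply/andP; split; apply: sumr_ge0 => x _.
  rewrite (_ : _ + _ = nu x * ((2 * e)^-1 * (e * f x + g x) ^+ 2)).
    by rewrite mulr_ge0// ltW.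
  by field; rewrite gt_eqF.
rewrite (_ : _ - _ = nu x * ((2 * e)^-1 * (e * f x + - g x) ^+ 2)).
  by rewrite mulr_ge0// ltW.
by field; rewrite gt_eqF.
Qed.

Lemma Pop_sym i f g : dot (Pop nu i f) g = dot f (Pop nu i g).
Proof.
rewrite !PopE /dot /Ex /kop.
under eq_bigr do rewrite mulr_suml mulr_sumr.
under [RHS]eq_bigr do rewrite !mulr_sumr.
rewrite exchange_big; apply: eq_bigr => x _; apply: eq_bigr => y _ /=.
rewrite (_ : _ * _ = nu y * gker i y x * (f x * g y)); last by ring.
by rewrite gker_reversible; ring.
Qed.

Lemma Lop_sym i f g : dot (Lop nu i f) g = dot f (Lop nu i g).
Proof. by rewrite dotBl dotBr Pop_sym. Qed.

(** [P_i] is a self-adjoint idempotent, so [- L_i] is an orthogonal projection in L_2. *)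
Lemma dot_Lop_Lop i f g : dot (Lop nu i f) (Lop nu i g) = - dot f (Lop nu i g).
Proof.
by rewrite dotBl [dot (Pop _ _ _) _]dotBr !Pop_sym Pop_idem subrr sub0r.
Qed.

Lemma Lop_contraction i f : dot (Lop nu i f) (Lop nu i f) <= dot f f.
Proof.
rewrite dot_Lop_Lop dotBr -Pop_idem -Pop_sym opprB gerBl.
exact: dot_ge0.
Qed.

Lemma PopB i f g : Pop nu i (fun x => f x - g x) =
  fun x => Pop nu i f x - Pop nu i g x.
Proof.
apply/funext => x; rewrite !PopE /kop -sumrB.
by apply: eq_bigr => y _; rewrite mulrBr.
Qed.

Lemma Pop_cst i (a : R) : Pop nu i (fun=> a) = fun=> a.
Proof.
by apply/funext => x; rewrite !PopE /kop -mulr_suml gker_sum1 mul1r.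
Qed.

Lemma Pop_sum i (I : finType) (F : I -> T -> R) x :
  Pop nu i (fun x => \sum_k F k x) x = \sum_k Pop nu i (F k) x.
Proof.
under [RHS]eq_bigr do rewrite PopE.
rewrite PopE /kop exchange_big /=; apply: eq_bigr => y _.
by rewrite mulr_sumr.
Qed.

Lemma Lop_sum i (I : finType) (F : I -> T -> R) x :
  Lop nu i (fun x => \sum_k F k x) x = \sum_k Lop nu i (F k) x.
Proof. by rewrite /Lop Pop_sum -sumrB. Qed.

(** When the product is expanded, the diagonal terms collapse by unit row sums and reversibility. A
    sum over pairs with nonnegative weights lets two-point inequalities be lifted to Dirichlet
    forms. *)
Lemma dot_Lop_kernel i f g : - dot f (Lop nu i g) =
  2^-1 * \sum_x \sum_y nu x * gker i x y * ((f x - f y) * (g x - g y)).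
Proof.
have sum1 h : \sum_x \sum_y nu x * gker i x y * h x = Ex nu h.
  apply: eq_bigr => x _; rewrite -mulr_suml -mulr_sumr gker_sum1; ring.
have sum2 h : \sum_x \sum_y nu x * gker i x y * h y = Ex nu h.
  rewrite -sum1 exchange_big; apply: eq_bigr => x _; apply: eq_bigr => y _ /=.
  by rewrite gker_reversible.
have sum3 f' g' : \sum_x \sum_y nu x * gker i x y * (f' x * g' y) =
    dot f' (Pop nu i g').
  apply: eq_bigr => x _; rewrite PopE /kop !mulr_sumr.
  by apply: eq_bigr => y _; ring.
apply: (@mulfI _ 2) => //; rewrite mulVKf//.
transitivity (\sum_x \sum_y nu x * gker i x y * (f x * g x)
  + \sum_x \sum_y nu x * gker i x y * (f y * g y)
  - \sum_x \sum_y nu x * gker i x y * (f x * g y)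
  - \sum_x \sum_y nu x * gker i x y * (g x * f y)).
  rewrite (sum1 (fun x => f x * g x)) (sum2 (fun x => f x * g x)) !sum3.
  have -> : dot g (Pop nu i f) = dot f (Pop nu i g) by rewrite -Pop_sym dotC.
  by rewrite dotBr /dot; ring.
rewrite -big_split -!sumrB; apply: eq_bigr => x _ /=.
rewrite -big_split -!sumrB; apply: eq_bigr => y _ /=; ring.
Qed.

Lemma dirichletE f : dirichlet nu f = \sum_i dot (Lop nu i f) (Lop nu i f).
Proof. by apply: eq_bigr => i _; apply: eq_bigr => x _; rewrite expr2. Qed.

Lemma dirichlet_ge0 f : 0 <= dirichlet nu f.
Proof. by rewrite dirichletE sumr_ge0// => i _; exact: dot_ge0. Qed.

Definition gen f : T -> R := fun x => \sum_(i < n) Lop nu i f x.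

Lemma gen_sym f g : dot (gen f) g = dot f (gen g).
Proof.
rewrite dotC !dot_sumr; apply: eq_bigr => i _.
by rewrite dotC Lop_sym.
Qed.

Lemma dot_gen f : dot f (gen f) = - dirichlet nu f.
Proof.
rewrite dirichletE dot_sumr -sumrN; apply: eq_bigr => i _.
by rewrite dot_Lop_Lop opprK.
Qed.

End GlauberOperators.

(** * The heat semigroup *)

Section HeatSemigroup.
Variables (R : realType) (n : nat) (Sigma : finType).
Notation T := (config n Sigma).
Variable nu : T -> R.
Hypothesis nu_gt0 : forall x, 0 < nu x.
Implicit Types (f g h u : T -> R) (x y : T) (i j : 'I_n) (s t : R).

Lemma is_derive_dot (F G : R -> T -> R) (dF dG : T -> R) t :
  (forall x, is_derive t 1 (fun s => F s x) (dF x)) ->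
  (forall x, is_derive t 1 (fun s => G s x) (dG x)) ->
  is_derive t 1 (fun s => dot nu (F s) (G s))
    (dot nu dF (G t) + dot nu (F t) dG).
Proof.
move=> hF hG.
have := is_derive_sum_fin (fun x => is_deriveZ (nu x) (is_deriveM (hF x) (hG x))).
move=> H; refine (is_derive_eq H _).
rewrite /dot /Ex -big_split; apply: eq_bigr => x _ /=.
by rewrite /GRing.scale /=; ring.
Qed.

Lemma is_derive_Lop (F : R -> T -> R) (dF : T -> R) i x t :
  (forall y, is_derive t 1 (fun s => F s y) (dF y)) ->
  is_derive t 1 (fun s => Lop nu i (F s) x) (Lop nu i dF x).
Proof.
move=> hF; rewrite /Lop PopE.
rewrite (_ : (fun s => _) =
    (fun s => \sum_y gker nu i x y * F s y) - (F^~ x)); last first.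
  by apply/funext => s; rewrite PopE.
apply: is_deriveB; apply: is_derive_sum_fin => y.
Qed.

(* The generator is [K - n] with [K := sum_i P_i], so that the exponential series is
that of the entrywise nonnegative kernel [K]: this makes positivity immediate. *)
Definition heat t f : T -> R := fun x =>
  expR (- (n%:R * t)) * kexp (fun x y => \sum_(i < n) gker nu i x y) t f x.

Lemma is_derive_heat t f x :
  is_derive t 1 (fun s => heat s f x) (gen nu (heat t f) x).
Proof.
have dexp : is_derive t 1 (fun s => expR (- (n%:R * s)))
    (expR (- (n%:R * t)) * - n%:R).
  have := is_deriveN (is_deriveZ n%:R (is_derive_id t (1 : R))).
  rewrite /GRing.scale /= mulr1 => dn.
  exact: (is_derive1_comp (is_derive_expR _) dn).
refine (is_derive_eq (is_deriveM dexp (is_derive_kexp _ _ _ _)) _).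
rewrite /gen /Lop sumrB sumr_const card_ord -[heat t f x *+ n]mulr_natl.
rewrite /heat /GRing.scale /=.
under [X in _ = X - _]eq_bigr do rewrite PopE /kop.
rewrite exchange_big /= /kop mulr_sumr.
rewrite (eq_bigr (fun y => \sum_(i < n) gker nu i x y * (expR (- (n%:R * t)) *
   kexp (fun x y => \sum_(i < n) gker nu i x y) t f y))); last first.
  by move=> y _; rewrite -mulr_suml mulrCA.
by ring.
Qed.

Lemma heat0 f : heat 0 f = f.
Proof.
by apply/funext => x; rewrite /heat mulr0 oppr0 expR0 mul1r kexp0.
Qed.

Lemma heat_ge0 t f : 0 <= t -> (forall x, 0 <= f x) -> forall x, 0 <= heat t f x.
Proof.
move=> t0 f0 x; rewrite mulr_ge0 ?expR_ge0//; apply: kexp_ge0 => // y z.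
by apply: sumr_ge0 => i _; exact: gker_ge0.
Qed.

Lemma is_derive_dot_heat t f :
  is_derive t 1 (fun s => dot nu (heat s f) (heat s f))
    (- (2 * dirichlet nu (heat t f))).
Proof.
refine (is_derive_eq (is_derive_dot (is_derive_heat t f) (is_derive_heat t f)) _).
by rewrite gen_sym// !dot_gen//; ring.
Qed.

Lemma heat_contraction s t f : s <= t ->
  dot nu (heat t f) (heat t f) <= dot nu (heat s f) (heat s f).
Proof.
move=> st; apply: (@is_derive_le0_nincr _ (fun r => dot nu (heat r f) (heat r f))
  (fun r => - (2 * dirichlet nu (heat r f))) _ _ st) => r _.
  exact: is_derive_dot_heat.
by rewrite oppr_le0 mulr_ge0// dirichlet_ge0.
Qed.

Lemma is_derive_heat_rev t s f x :
  is_derive s 1 (fun r => heat (t - r) f x) (- gen nu (heat (t - s) f) x).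
Proof.
have d : is_derive s 1 (fun r => t - r) (-1).
  have := is_deriveB (is_derive_cst t s 1) (is_derive_id s (1 : R)).
  by rewrite sub0r.
have := @is_derive1_comp _ (fun r => heat r f x) (fun r => t - r) _ _ _
  (is_derive_heat (t - s) f x) d.
by rewrite mulrN1.
Qed.

Lemma heat_sym t f g : dot nu (heat t f) g = dot nu f (heat t g).
Proof.
(* Constant in [s], as the generator is symmetric. *)
pose F s := dot nu (heat s f) (heat (t - s) g).
have : F t = F 0.
  apply: is_derive_0_is_cst => s.
  have := is_derive_dot (is_derive_heat s f) (is_derive_heat_rev t s g).
  move=> H; refine (is_derive_eq H _).
  rewrite gen_sym// -dotDr; apply: big1 => x _.
  by rewrite addrN !mulr0.
by rewrite /F subrr subr0 !heat0.
Qed.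

(** Testing against all [h] lets additivity of [heat t] and its action on constants be deduced from
    [heat_sym], without returning to the series. *)
Lemma dot_inj f g : (forall h, dot nu f h = dot nu g h) -> f = g.
Proof.
move=> fg; apply/funext => x; apply/eqP; rewrite -subr_eq0; apply/eqP.
apply: (@dot_eq0 _ _ _ _ nu_gt0 (fun x => f x - g x)).
by rewrite dotBl fg subrr.
Qed.

Lemma heatB t f g : heat t (fun x => f x - g x) =
  fun x => heat t f x - heat t g x.
Proof. by apply: dot_inj => h; rewrite heat_sym !dotBl !heat_sym. Qed.

Lemma gen_cst (a : R) : gen nu (fun=> a) = fun=> 0.
Proof.
by apply/funext => x; rewrite /gen /Lop; apply: big1 => i _; rewrite Pop_cst// subrr.
Qed.

Lemma Ex_dot1 f : Ex nu f = dot nu (fun=> 1) f.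
Proof. by apply: eq_bigr => x _; rewrite mul1r. Qed.

(** The time derivative of the mean is [<1, gen u> = <gen 1, u> = 0]. *)
Lemma Ex_heat t f : Ex nu (heat t f) = Ex nu f.
Proof.
rewrite !Ex_dot1 -{2}(heat0 f).
apply: (@is_derive_0_is_cst _ (fun s => dot nu (fun=> 1) (heat s f))) => s.
have := is_derive_dot (fun x => is_derive_cst (1 : R) s 1) (is_derive_heat s f).
move=> H; refine (is_derive_eq H _).
rewrite -gen_sym// gen_cst.
by rewrite /dot /Ex -big_split /=; apply: big1 => x _; rewrite !mul0r mulr0 addr0.
Qed.

Lemma heat_cst t (a : R) : heat t (fun=> a) = fun=> a.
Proof.
apply: dot_inj => h; rewrite heat_sym.
have E u : dot nu (fun=> a) u = a * Ex nu u.
  by rewrite /dot /Ex mulr_sumr; apply: eq_bigr => x _; ring.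
by rewrite !E Ex_heat.
Qed.

Lemma heat_le t f g : 0 <= t -> (forall x, f x <= g x) ->
  forall x, heat t f x <= heat t g x.
Proof.
move=> t0 fg x; rewrite -subr_ge0; have := @heat_ge0 t (fun x => g x - f x) t0.
by rewrite heatB; apply => y; rewrite subr_ge0.
Qed.

Lemma heatN t f : heat t (fun x => - f x) = fun x => - heat t f x.
Proof.
rewrite (_ : (fun x => - f x) = fun x => (fun=> 0) x - f x).
  by rewrite heatB heat_cst; apply/funext => x; rewrite sub0r.
by apply/funext => x; rewrite sub0r.
Qed.

Lemma normr_heat_le t f x : 0 <= t -> `|heat t f x| <= heat t (fun y => `|f y|) x.
Proof.
move=> t0; rewrite ler_norml; apply/andP; split.
  rewrite lerNl -[- _]/((fun x => - heat t f x) x) -heatN.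
  by apply: heat_le => // y; rewrite -normrN ler_norm.
by apply: heat_le => // y; rewrite ler_norm.
Qed.

(** A positive function on a finite space is bounded below by a positive constant, which the
    semigroup fixes. Strict positivity is what later makes logarithms along the flow
    differentiable. *)
Lemma heat_gt0 t f : 0 <= t -> (forall x, 0 < f x) -> forall x, 0 < heat t f x.
Proof.
move=> t0 f0 x; have [x0 _ x0min] := @arg_minP _ _ _ x xpredT f isT.
apply: (lt_le_trans (f0 x0)).
have := @heat_le t (fun=> f x0) f t0 (fun y => x0min y isT) x.
by rewrite heat_cst.
Qed.

End HeatSemigroup.

(** * Hypercontractivity *)

Section PowerInequality.
Variable R : realType.
Implicit Types (a b l q x y z : R).

Lemma addV_le_homo a b : 1 <= a -> a <= b -> a + a^-1 <= b + b^-1.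
Proof.
move=> a1 ab; have a0 : 0 < a by apply: lt_le_trans a1.
have b0 : 0 < b by apply: lt_le_trans ab.
rewrite -subr_ge0 (_ : _ - _ = (b - a) * (1 - (a * b)^-1)); last first.
  by field; rewrite !gt_eqF.
rewrite mulr_ge0 ?subr_ge0// invf_le1 ?mulr_gt0//.
by rewrite -[leLHS]mulr1 ler_pM// (le_trans a1).
Qed.

(** Both sides vanish at [z = 0], and the derivatives compare because [cosh (l z) <= cosh z];
    [addV_le_homo] is this monotonicity in the variable [e^z]. *)
Lemma sinh_convex l z : 0 <= l <= 1 -> 0 <= z ->
  expR (l * z) - expR (- (l * z)) <= l * (expR z - expR (- z)).
Proof.
move=> /andP[l0 l1] z0; rewrite -subr_le0.
have dexp (k t : R) : is_derive t 1 (fun z => expR (k * z)) (k * expR (k * t)).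
  have dk := is_deriveZ k (is_derive_id t (1 : R)).
  have := @is_derive1_comp _ expR (fun z => k * z) _ _ _ (is_derive_expR _) dk.
  by rewrite /GRing.scale /= mulr1 mulrC.
pose F z := (expR (l * z) - expR (- l * z)) - l * (expR (1 * z) - expR ((-1) * z)).
pose dF z := (l * expR (l * z) - (- l * expR (- l * z))) -
  l * (1 * expR (1 * z) - (-1 * expR ((-1) * z))).
have -> : expR (l * z) - expR (- (l * z)) - l * (expR z - expR (- z)) = F z.
  by rewrite /F !mulNr !mul1r.
have -> : 0 = F 0 by rewrite /F !mulr0 !subrr mulr0 subrr.
apply: (@is_derive_le0_nincr _ F dF 0 z z0) => t /andP[t0 _].
rewrite /dF !mulNr !mul1r !opprK -mulrDr -mulrBr mulr_ge0_le0// subr_le0.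
rewrite !expRN addV_le_homo//; first by rewrite -expR0 ler_expR mulr_ge0.
by rewrite ler_expR ler_piMl.
Qed.

Lemma stroock_varopoulos q x y : 1 <= q <= 2 -> 0 < x -> 0 < y ->
  4 * (q - 1) * (x `^ (q / 2) - y `^ (q / 2)) ^+ 2 <=
  q ^+ 2 * ((x - y) * (x `^ (q - 1) - y `^ (q - 1))).
Proof.
move=> /andP[q1 q2]; have q0 : 0 < q by apply: lt_le_trans q1.
(* With [x = e^(m + d)] and [y = e^(m - d)] the claim reduces, after division by
   [e^(q m)], to [sinh (l z) <= l sinh z] for [z = q d / 2] and [l = (2 - q) / q]. *)
wlog yx : x y / y <= x => [hw x0 y0|x0 y0].
  have [yx|/ltW xy] := leP y x; first exact: hw.
  rewrite -[_ - y `^ _]opprB sqrrN -[x - y]opprB -[x `^ (q - 1) - _]opprB mulrNN.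
  exact: hw.
set m := (ln x + ln y) / 2; set d := (ln x - ln y) / 2.
have d0 : 0 <= d by rewrite divr_ge0// subr_ge0 ler_ln.
have powE (r : R) : (x `^ r = expR (r * m) * expR (r * d)) *
    (y `^ r = expR (r * m) * expR (- (r * d))).
  by rewrite /powR !gt_eqF// -!expRD; split; congr expR; rewrite /m /d; field.
set A := expR (q / 2 * d); set C := expR ((2 - q) / 2 * d).
have A0 : 0 < A := expR_gt0 _.
have C0 : 0 < C := expR_gt0 _.
have hC : C - C^-1 <= (2 - q) / q * (A - A^-1).
  rewrite -!expRN /C /A (_ : (2 - q) / 2 * d = (2 - q) / q * (q / 2 * d)); last first.
    by field; rewrite gt_eqF.
  apply: sinh_convex; last by rewrite mulr_ge0// divr_ge0// ltW.
  by rewrite divr_ge0 ?subr_ge0 ?(ltW q0)//= ler_pdivrMr// mul1r; lra.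
have C1 : 0 <= C - C^-1.
  rewrite -expRN subr_ge0 ler_expR.
  by rewrite (@le_trans _ _ 0)// ?oppr_le0 mulr_ge0// divr_ge0// subr_ge0.
(* The claim reduces to this because [(A C - 1/(A C)) (A/C - C/A) = (A - 1/A)^2 - (C - 1/C)^2] and
   [q^2 - 4 (q - 1) = (2 - q)^2]. *)
have key : (q * (C - C^-1)) ^+ 2 <= ((2 - q) * (A - A^-1)) ^+ 2.
  rewrite ler_sqr ?nnegrE.
  - apply: le_trans (ler_wpM2l (ltW q0) hC) _.
    by rewrite mulrA mulrCA divff ?mulr1// gt_eqF.
  - by rewrite mulr_ge0// ltW.
  - rewrite mulr_ge0 ?subr_ge0// -expRN ler_expR.
    by rewrite (@le_trans _ _ 0)// ?oppr_le0 mulr_ge0// divr_ge0// ltW.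
have E1 : expR (1 * d) = A * C by rewrite -expRD; congr expR; field.
have E2 : expR ((q - 1) * d) = A / C by rewrite -expRN -expRD; congr expR; field.
have M : expR (1 * m) * expR ((q - 1) * m) = expR (q / 2 * m) ^+ 2.
  by rewrite expr2 -!expRD; congr expR; field.
rewrite -[in x - y](powRr1 (ltW x0)) -[in _ - y](powRr1 (ltW y0)) !powE.
rewrite !expRN E1 E2 -/A.
rewrite (_ : _ * (_ ^+ 2) =
  expR (q / 2 * m) ^+ 2 * (4 * (q - 1) * (A - A^-1) ^+ 2)); last by ring.
rewrite (_ : q ^+ 2 * _ = (expR (1 * m) * expR ((q - 1) * m)) *
   ((q * (A - A^-1)) ^+ 2 - (q * (C - C^-1)) ^+ 2)); last first.
  by field; rewrite !gt_eqF.
rewrite M ler_wpM2l ?sqr_ge0//.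
rewrite -subr_ge0 in key; rewrite -subr_ge0; apply: le_trans key _.
by rewrite le_eqVlt; apply/orP; left; apply/eqP; ring.
Qed.

End PowerInequality.

Section Hypercontractivity.
Variables (R : realType) (n : nat) (Sigma : finType).
Notation T := (config n Sigma).
Variable nu : T -> R.
Hypothesis nu_gt0 : forall x, 0 < nu x.
Hypothesis nu_sum1 : \sum_x nu x = 1.
Implicit Types (f g h u : T -> R) (x y : T) (i j : 'I_n) (s t : R).

(** The two-point inequality, weighted by [nu x * gker nu i x y] and summed through
    [dot_Lop_kernel]. *)
Lemma dirichlet_powR q g : 1 <= q <= 2 -> (forall x, 0 < g x) ->
  4 * (q - 1) * dirichlet nu (fun x => g x `^ (q / 2)) <=
  - (q ^+ 2 * dot nu (fun x => g x `^ (q - 1)) (gen nu g)).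
Proof.
move=> q12 g0; rewrite dirichletE dot_sumr -mulrN -sumrN !mulr_sumr.
apply: ler_sum => i _; rewrite dot_Lop_Lop// !dot_Lop_kernel//.
rewrite !mulr_sumr; apply: ler_sum => x _.
rewrite !mulr_sumr; apply: ler_sum => y _.
have w0 : 0 <= nu x * gker nu i x y by rewrite mulr_ge0 ?gker_ge0// ltW.
have := ler_wpM2l w0 (stroock_varopoulos q12 (g0 x) (g0 y)).
rewrite -subr_ge0 => H; rewrite -subr_ge0.
rewrite (_ : _ - _ = 2^-1 * (nu x * gker nu i x y * (q ^+ 2 *
  ((g x - g y) * (g x `^ (q - 1) - g y `^ (q - 1)))) -
  nu x * gker nu i x y * (4 * (q - 1) * (g x `^ (q / 2) - g y `^ (q / 2)) ^+ 2))).
  by rewrite mulr_ge0.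
by ring.
Qed.

Lemma Ent_powR rho q g : log_sobolev nu rho -> (forall x, 0 < g x) ->
  rho * Ent nu (fun x => g x `^ q) <= 2 * dirichlet nu (fun x => g x `^ (q / 2)).
Proof.
move=> lsi g0; have := lsi (fun x => g x `^ q) (fun x => powR_ge0 _ _).
congr (_ <= 2 * dirichlet _ _); apply/funext => x.
by rewrite -powR12_sqrt ?powR_ge0// -powRrM.
Qed.

Lemma Ex_gt0 f : (forall x, 0 < f x) -> 0 < Ex nu f.
Proof.
move=> f0; have nuf0 x : 0 < nu x * f x by rewrite mulr_gt0.
rewrite lt_def sumr_ge0 ?andbT => [|x _]; last exact: ltW.
apply/eqP => /psumr_eq0P E; move: (oner_neq0 R); rewrite -nu_sum1 big1 ?eqxx//.
by move=> x _; have := nuf0 x; rewrite E ?ltxx// => y _; exact: ltW.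
Qed.

Lemma hypercontractive_pos rho t f : 0 < rho -> log_sobolev nu rho -> 0 <= t ->
  (forall x, 0 < f x) ->
  dot nu (heat nu t f) (heat nu t f) <=
    norm_p nu (1 + expR (- (2 * rho * t))) f ^+ 2.
Proof.
move=> rho0 lsi t0 f0.
(* The exponent solves [q' = 2 rho (q - 1)] with [q t = 2]: this is the speed at which the
   log-Sobolev inequality balances entropy growth against dissipation. *)
pose q s := 1 + expR (2 * rho * (s - t)).
pose dq s := expR (2 * rho * (s - t)) * (2 * rho).
have q1 s : 1 < q s by rewrite /q ltrDl expR_gt0.
have q0 s : 0 < q s by apply: lt_trans (q1 s).
have q2 s : s <= t -> q s <= 2.
  move=> st; rewrite /q (_ : 2 = 1 + 1)// lerD2l -expR0 ler_expR.
  by rewrite mulr_ge0_le0 ?subr_le0// mulr_ge0// ltW.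
have dqE s : dq s = 2 * rho * (q s - 1) by rewrite /dq /q; ring.
have deriv_q s : is_derive s 1 q (dq s).
  have d : is_derive s 1 (fun r => 2 * rho * (r - t)) (2 * rho).
    have := is_deriveZ (2 * rho)
      (is_deriveB (is_derive_id s (1 : R)) (is_derive_cst t s 1)).
    by rewrite /GRing.scale /= subr0 mulr1.
  have := is_deriveD (is_derive_cst (1 : R) s 1)
    (@is_derive1_comp _ expR (fun r => 2 * rho * (r - t)) _ _ _ (is_derive_expR _) d).
  by rewrite add0r.
pose g s := heat nu s f.
pose dg s := gen nu (g s).
have g0 s x : 0 <= s -> 0 < g s x by move=> s0; exact: heat_gt0.
(* Base and exponent both move with [s], so the power is written through [expR]; this also keeps [S]
   positive for every real [s]. *)
pose h s x := expR (q s * ln (g s x)).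
pose dh s x := h s x * (q s * ((g s x)^-1 * dg s x) + ln (g s x) * dq s).
have hE s x : 0 <= s -> h s x = g s x `^ q s.
  by move=> s0; rewrite /powR gt_eqF// g0.
pose S s := \sum_x nu x * h s x.
pose dS s := \sum_x nu x * dh s x.
have S0 s : 0 < S s by apply: Ex_gt0 => x; exact: expR_gt0.
have deriv_S s : 0 <= s -> is_derive s 1 S (dS s).
  move=> s0; apply: is_derive_sum_fin => x; apply: is_deriveZ.
  have dl := @is_derive1_comp _ (@ln R) (fun r => g r x) s _ _
    (is_derive1_ln (g0 s x s0)) (is_derive_heat nu s f x).
  exact: (@is_derive1_comp _ expR (fun r => q r * ln (g r x)) s _ _
    (is_derive_expR _) (is_deriveM (deriv_q s) dl)).
(* [expR (phi s)] is the norm of [P_s f] of exponent [q s], which goes from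
   [1 + e^(-2 rho t)] at [s = 0] to [2] at [s = t]. *)
pose phi s := (q s)^-1 * ln (S s).
pose dphi s := (q s)^-1 * ((S s)^-1 * dS s) + ln (S s) * (- (q s) ^- 2 * dq s).
have deriv_phi s : 0 <= s -> is_derive s 1 phi (dphi s).
  move=> s0.
  have dl := @is_derive1_comp _ (@ln R) S s _ _ (is_derive1_ln (S0 s)) (deriv_S s s0).
  exact: (is_deriveM (is_deriveV (lt0r_neq0 (q0 s)) (deriv_q s)) dl).
have phi_le : phi t <= phi 0.
  apply: (@is_derive_le0_nincr _ phi dphi _ _ t0) => s /andP[s0 st].
    exact: deriv_phi.
  have -> : dphi s = (q s ^+ 2 * S s)^-1 * (q s * dS s - dq s * (S s * ln (S s))).
    by rewrite /dphi; field; rewrite !gt_eqF.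
  rewrite mulr_ge0_le0//; first by rewrite invr_ge0 mulr_ge0 ?sqr_ge0// ltW.
  have SE : S s = Ex nu (fun x => g s x `^ q s).
    by apply: eq_bigr => x _; rewrite hE.
  (* After subtracting [dq s * S s * ln (S s)] there remains [q' Ent(g^q) + q^2 <g^(q-1), gen g>].
     As [q' = 2 rho (q - 1)], [Ent_powR] bounds the entropy term by [4 (q - 1)] times the Dirichlet
     form of [g^(q/2)], which [dirichlet_powR] compensates. *)
  have -> : q s * dS s = dq s * Ex nu (fun x => g s x `^ q s * ln (g s x `^ q s)) +
      q s ^+ 2 * dot nu (fun x => g s x `^ (q s - 1)) (dg s).
    rewrite /dS /dot /Ex !mulr_sumr -big_split; apply: eq_bigr => x _ /=.
    rewrite /dh hE// ln_powR -(mulr_powRB1 (ltW (g0 s x s0)) (q0 s)).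
    by field; rewrite gt_eqF ?g0.
  rewrite SE addrAC -mulrBr -/(Ent _ _).
  have q12 : 1 <= q s <= 2 by rewrite (ltW (q1 s)) q2.
  have qm1 : 0 <= 2 * (q s - 1) by rewrite mulr_ge0// subr_ge0 ltW.
  have := ler_wpM2l qm1 (Ent_powR (q s) lsi (fun x => g0 s x s0)).
  have := dirichlet_powR q12 (fun x => g0 s x s0).
  by rewrite /Ent dqE -/(dg s); lra.
have qt : q t = 2 by rewrite /q subrr mulr0 expR0.
have -> : dot nu (g t) (g t) = expR (phi t) ^+ 2.
  rewrite -expRM_natl /phi qt mulVKf// lnK ?posrE//.
  by apply: eq_bigr => x _; rewrite hE// qt (powR_mulrn 2) ?expr2// ltW// g0.
have -> : norm_p nu (1 + expR (- (2 * rho * t))) f = expR (phi 0).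
  have q00 : 1 + expR (- (2 * rho * t)) = q 0 by rewrite /q sub0r mulrN.
  have SE : S 0 = Ex nu (fun x => `|f x| `^ q 0).
    by apply: eq_bigr => x _; rewrite hE// /g heat0 gtr0_norm.
  by rewrite /norm_p q00 -SE /powR gt_eqF.
move: (phi t) (phi 0) phi_le => a b ab.
by rewrite ler_sqr ?nnegrE ?expR_ge0// ler_expR.
Qed.

Lemma hypercontractive rho t f : 0 < rho -> log_sobolev nu rho -> 0 <= t ->
  dot nu (heat nu t f) (heat nu t f) <=
    norm_p nu (1 + expR (- (2 * rho * t))) f ^+ 2.
Proof.
move=> rho0 lsi t0; set p := 1 + _.
have p0 : 0 < p by rewrite addr_gt0 ?expR_gt0.
set X := dot nu _ _; set M := Ex nu (fun x => `|f x| `^ p).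
have X0 : 0 <= X by exact: dot_ge0.
have M0 : 0 <= M by apply: sumr_ge0 => x _; rewrite mulr_ge0 ?powR_ge0// ltW.
have normE a : 0 <= a -> (a `^ p^-1) ^+ 2 = a `^ (2 / p).
  by move=> a0; rewrite -powR_mulrn ?powR_ge0// -powRrM mulrC.
have pK a : 0 <= a -> (a `^ (2 / p)) `^ (p / 2) = a.
  move=> a0; rewrite -powRrM (_ : _ * _ = 1) ?powRr1//.
  by field; rewrite gt_eqF.
(* Comparing p-th powers makes the approximation error an additive [d], which can be sent to 0. *)
suff XM : X `^ (p / 2) <= M.
  rewrite /norm_p normE// -/M -[X](_ : (X `^ (p / 2)) `^ (2 / p) = X).
    by rewrite ge0_ler_powR ?nnegrE ?powR_ge0// divr_ge0// ltW.
  rewrite -powRrM (_ : _ * _ = 1) ?powRr1//.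
  by field; rewrite gt_eqF.
apply/ler_addgt0Pr => d d0.
(* A positive majorant of |f|, whose p-th moment exceeds that of f by at most d. *)
pose fd x := if f x == 0 then d `^ p^-1 else `|f x|.
have fd0 x : 0 < fd x.
  by rewrite /fd; case: eqVneq => fx; rewrite ?powR_gt0 ?normr_gt0.
have ffd x : `|f x| <= fd x.
  by rewrite /fd; case: eqVneq => fx //; rewrite fx normr0 powR_ge0.
have fdM : Ex nu (fun x => `|fd x| `^ p) <= M + d.
  rewrite -(Ex_cst nu_sum1 d) /M /Ex -big_split; apply: ler_sum => x _ /=.
  rewrite -mulrDr ler_wpM2l ?(ltW (nu_gt0 x))// gtr0_norm// /fd.
  case: eqVneq => fx; last by rewrite lerDl ltW.
  by rewrite -powRrM mulVf ?gt_eqF// powRr1 ?(ltW d0)// lerDr powR_ge0.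
have XX : X <= dot nu (heat nu t fd) (heat nu t fd).
  apply: ler_sum => x _; rewrite ler_wpM2l ?(ltW (nu_gt0 x))// -!expr2.
  rewrite -[leLHS]real_normK ?num_real// ler_sqr ?nnegrE//; last first.
    by apply: heat_ge0 => // y; rewrite ltW.
  apply: le_trans (normr_heat_le nu_gt0 f x t0) _.
  exact: heat_le.
have fdM0 : 0 <= Ex nu (fun x => `|fd x| `^ p).
  by apply: sumr_ge0 => x _; rewrite mulr_ge0 ?powR_ge0// ltW.
apply: le_trans fdM; rewrite -[leRHS]pK// ge0_ler_powR ?nnegrE ?powR_ge0//.
  by rewrite divr_ge0// ltW.
apply: le_trans XX _; rewrite -normE//; exact: hypercontractive_pos.
Qed.

End Hypercontractivity.

(** * Variance decay *)

Section VarianceDecay.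
Variables (R : realType) (n : nat) (Sigma : finType).
Notation T := (config n Sigma).
Variable nu : T -> R.
Hypothesis nu_gt0 : forall x, 0 < nu x.
Hypothesis nu_sum1 : \sum_x nu x = 1.
Implicit Types (f g h u : T -> R) (x y : T) (i j : 'I_n) (s t : R).

(** With [m = |f|_2], average [2 f^2] times the bound [ln (m / f) <= m / f - 1]. This gives [Ent
    (f^2) >= 2 m^2 - 2 m E = (m - E)^2 + Var f]. *)
Lemma Var_le_Ent_sqr f : (forall x, 0 <= f x) ->
  Var nu f <= Ent nu (fun x => f x ^+ 2).
Proof.
move=> f0; rewrite VarE//; set M := dot nu f f; set E := Ex nu f.
have MD : Ex nu (fun x => f x ^+ 2) = M by apply: eq_bigr => x _; rewrite expr2.
rewrite /Ent MD.
have [M0|M0] := eqVneq M 0.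
  have fx0 := dot_eq0 nu_gt0 M0.
  rewrite M0 mul0r sub0r subr0 (@le_trans _ _ 0) ?oppr_le0 ?sqr_ge0//.
  by apply: sumr_ge0 => x _; rewrite fx0 expr0n mul0r mulr0.
have Mgt0 : 0 < M by rewrite lt_def M0 dot_ge0.
set m := Num.sqrt M.
have m0 : 0 < m by rewrite sqrtr_gt0.
have mM : M = m ^+ 2 by rewrite sqr_sqrtr// ltW.
have : Ex nu (fun x => f x ^+ 2 * ln M + 2 * f x ^+ 2 - 2 * m * f x) <=
    Ex nu (fun x => f x ^+ 2 * ln (f x ^+ 2)).
  apply: ler_sum => x _; rewrite ler_wpM2l ?(ltW (nu_gt0 x))//.
  have [->|fx] := eqVneq (f x) 0; first by rewrite expr0n !(mul0r, mulr0) subr0 addr0.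
  have fx0 : 0 < f x by rewrite lt_def fx f0.
  have : ln (m / f x) <= m / f x - 1.
    have := @le_ln1Dx _ (m / f x - 1).
    by rewrite addrCA subrr addr0; apply; rewrite ltrBrDr addNr divr_gt0.
  rewrite ln_div ?posrE// mM !lnXn// => H.
  have := ler_wpM2l (mulr_ge0 (ler0n R 2) (sqr_ge0 (f x))) H.
  rewrite (_ : _ * (m / f x - 1) = 2 * f x * m - 2 * f x ^+ 2); last by field.
  by rewrite ?mulr2n; lra.
rewrite (_ : Ex nu (fun x => _ - _) = M * ln M + 2 * M - 2 * m * E); last first.
  rewrite -MD /E /Ex mulr_suml !mulr_sumr -big_split -sumrB.
  by apply: eq_bigr => x _ /=; ring.
by have := sqr_ge0 (m - E); rewrite sqrrB -mM ?mulr2n; lra.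
Qed.

Lemma poincare rho f : log_sobolev nu rho -> 0 < rho ->
  rho * Var nu f <= 2 * dirichlet nu f.
Proof.
move=> lsi rho0.
(* A constant shift makes [f] nonnegative, so that [sqrt (f ^ 2) = f]. *)
pose c := \sum_x `|f x|; pose g x := f x + c.
have g0 x : 0 <= g x.
  rewrite /g -lerBlDr sub0r /c (bigD1 x)//= opprD.
  rewrite (@le_trans _ _ (- `|f x|))// ?gerDl ?oppr_le0 ?sumr_ge0//.
  by rewrite lerNl -normrN ler_norm.
have -> : Var nu f = Var nu g.
  rewrite /Var (_ : Ex nu g = Ex nu f + c).
    by apply: eq_bigr => x _; rewrite /g; ring.
  rewrite -(Ex_cst nu_sum1 c) /Ex -big_split.
  by apply: eq_bigr => x _; rewrite /g /=; ring.
have -> : dirichlet nu f = dirichlet nu (fun x => Num.sqrt (g x ^+ 2)).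
  rewrite (_ : (fun x => Num.sqrt _) = fun x => f x - (fun=> - c) x); last first.
    by apply/funext => x; rewrite sqrtr_sqr ger0_norm// opprK.
  rewrite !dirichletE; apply: eq_bigr => i _.
  suff -> : Lop nu i (fun x => f x - (fun=> - c) x) = Lop nu i f by [].
  by rewrite /Lop PopB Pop_cst//; apply/funext => x; ring.
apply: le_trans (lsi _ (fun x => sqr_ge0 _)).
by rewrite ler_wpM2l ?(ltW rho0)// Var_le_Ent_sqr.
Qed.

Lemma Var_heatE s f : Var nu (heat nu s f) =
  dot nu (heat nu s f) (heat nu s f) - Ex nu f ^+ 2.
Proof. by rewrite VarE// Ex_heat. Qed.

(** By the Poincare inequality [e^(rho s) Var (P_s f)] is nonincreasing in [s]. Since the mean is
    preserved, the drop in variance equals the drop in the squared L_2 norm. *)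
Lemma variance_decay rho t f : log_sobolev nu rho -> 0 < rho -> 0 <= t ->
  (1 - expR (- (rho * t))) * Var nu f <=
    dot nu f f - dot nu (heat nu t f) (heat nu t f).
Proof.
move=> lsi rho0 t0.
pose V s := expR (rho * s) * Var nu (heat nu s f).
pose dV s := expR (rho * s) * (- (2 * dirichlet nu (heat nu s f))) +
  Var nu (heat nu s f) * (expR (rho * s) * rho).
have : V t <= V 0.
  apply: (@is_derive_le0_nincr _ V dV _ _ t0) => s _.
    have de : is_derive s 1 (fun r => expR (rho * r)) (expR (rho * s) * rho).
      apply: (@is_derive1_comp _ expR (fun r => rho * r) _ _ _ (is_derive_expR _)).
      by have := is_deriveZ rho (is_derive_id s (1 : R)); rewrite /GRing.scale /= mulr1.
    apply: is_deriveM.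
    rewrite (_ : (fun s => _) = (fun s => dot nu (heat nu s f) (heat nu s f)) -
      cst (Ex nu f ^+ 2)).
      rewrite -[- (2 * _)]subr0.
      exact: (is_deriveB (is_derive_dot_heat nu_gt0 s f) (is_derive_cst _ _ _)).
    by apply/funext => r; rewrite Var_heatE.
  rewrite /dV mulrCA -mulrDr mulr_ge0_le0 ?expR_ge0// addrC subr_le0 mulrC.
  exact: poincare.
rewrite /V mulr0 expR0 mul1r heat0 => H.
have : Var nu (heat nu t f) <= expR (- (rho * t)) * Var nu f.
  by rewrite expRN ler_pdivlMl ?expR_gt0.
rewrite Var_heatE VarE//; lra.
Qed.

End VarianceDecay.

(** * Markov random fields *)

Section MarkovRandomField.
Local Open Scope set_scope.
Variables (R : realType) (n : nat) (Sigma : finType).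
Notation T := (config n Sigma).
Variable nu : T -> R.
Hypothesis nu_gt0 : forall x, 0 < nu x.
Implicit Types (f g h u : T -> R) (x y : T) (i j : 'I_n) (a : Sigma).

Definition upd x i a : T := [ffun k => if k == i then a else x k].

Lemma updC x i j a (c : Sigma) : i != j ->
  upd (upd x i a) j c = upd (upd x j c) i a.
Proof.
move=> ij; apply/ffunP => k; rewrite !ffunE.
by case: eqVneq => // ->; rewrite eq_sym (negbTE ij).
Qed.

Lemma upd_in_agree (S : {set 'I_n}) x i a : i \notin S -> upd x i a \in agree S x.
Proof.
move=> iS; rewrite inE; apply/forallP => k; apply/implyP => kS; rewrite ffunE.
by case: (eqVneq k i) kS => [->|//]; rewrite (negbTE iS).
Qed.

Lemma sum_agree_upd i x f :
  \sum_(y in agree [set~ i] x) f y = \sum_a f (upd x i a).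
Proof.
rewrite (reindex_onto (upd x i) (fun y => y i)) /=.
  apply: eq_bigl => a; rewrite upd_in_agree ?inE ?negbK ?eqxx//.
  by rewrite ffunE !eqxx.
move=> y; rewrite inE => /forallP xy; apply/ffunP => k; rewrite ffunE.
by case: eqVneq => [->//|ki]; have := xy k; rewrite !inE ki /= => /eqP.
Qed.

(** The conditional probability of symbol [a] at site [i] given the other coordinates of [x]. *)
Definition site_law i a x : R := nu (upd x i a) / Pr nu (agree [set~ i] x).

Lemma Pop_site_law i f x : Pop nu i f x = \sum_a site_law i a x * f (upd x i a).
Proof.
rewrite /Pop /condEx sum_agree_upd mulr_suml.
by apply: eq_bigr => a _; rewrite /site_law mulrAC.
Qed.

(** As [i] is not its own neighbor, fixing all other coordinates refines fixing the neighbors.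
    Adding the symbol at [i] leaves a single configuration, so the Markov factorization becomes this
    identity once the mass of the neighbor event cancels. *)
Lemma site_lawE (e : rel 'I_n) i a x : irreflexive e ->
  markov_random_field nu e ->
  site_law i a x = condPr nu (agree [set i] (upd x i a)) (agree (neighbors e i) x).
Proof.
move=> irr mrf; set N := neighbors e i.
have PN0 : Pr nu (agree N x) != 0 by rewrite gt_eqF// Pr_agree_gt0.
have P0 : Pr nu (agree [set~ i] x) != 0 by rewrite gt_eqF// Pr_agree_gt0.
have sub : agree [set~ i] x \subset agree N x.
  apply/fintype.subsetP => y; rewrite !inE => /forallP xy; apply/forallP => k.
  apply/implyP => kN; have := xy k; rewrite !inE.
  by case: eqVneq kN => [->|//]; rewrite inE irr.
have single : agree [set i] (upd x i a) :&: agree [set~ i] x = [set upd x i a].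
  apply/setP => y; rewrite !inE; apply/andP/eqP => [[/forallP y1 /forallP y2]|->].
    apply/ffunP => k; rewrite ffunE; case: eqVneq => [->|ki].
      by have := y1 i; rewrite inE eqxx ffunE eqxx => /eqP.
    by have := y2 k; rewrite !inE ki => /eqP.
  split; apply/forallP => k; rewrite !inE; first by rewrite eqxx implybT.
  by rewrite ffunE; case: eqVneq => //=; rewrite eqxx.
have := mrf i (upd x i a) x x PN0; rewrite single.
rewrite {1 3}/condPr (finset.setIidPl sub) -/N.
rewrite (_ : [set upd x i a] :&: agree N x = [set upd x i a]); last first.
  apply/finset.setIidPl; rewrite finset.sub1set (fintype.subsetP sub)//.
  by rewrite upd_in_agree// !inE eqxx.
rewrite {1}/Pr big_set1 mulrA => /(mulIf (invr_neq0 PN0)) E.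
by rewrite /site_law E mulfK.
Qed.

Lemma site_law_upd (e : rel 'I_n) i j a (c : Sigma) x : irreflexive e ->
  markov_random_field nu e -> i != j -> ~~ e i j ->
  site_law i a (upd x j c) = site_law i a x.
Proof.
move=> irr mrf ij eij; rewrite !(site_lawE _ _ _ irr mrf); congr condPr.
  by rewrite -updC//; apply: agree_eq; rewrite upd_in_agree// inE eq_sym.
by apply: agree_eq; rewrite upd_in_agree// inE.
Qed.

(** For distinct non-adjacent sites each site law ignores the other coordinate, so both compositions
    are the same double sum over symbols. *)
Lemma Pop_comm (e : rel 'I_n) i j f : irreflexive e -> symmetric e ->
  markov_random_field nu e -> i != j -> ~~ e i j ->
  Pop nu i (Pop nu j f) = Pop nu j (Pop nu i f).
Proof.
move=> irr sym mrf ij eij; have ji : j != i by rewrite eq_sym.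
have eji : ~~ e j i by rewrite sym.
apply/funext => x; rewrite !Pop_site_law.
under eq_bigr => a _.
  rewrite Pop_site_law mulr_sumr.
  under eq_bigr => c _ do rewrite (site_law_upd _ _ _ irr mrf ji eji) updC// mulrCA.
  over.
rewrite exchange_big; apply: eq_bigr => c _ /=.
rewrite Pop_site_law mulr_sumr; apply: eq_bigr => a _.
by rewrite (site_law_upd _ _ _ irr mrf ij eij).
Qed.

Lemma Lop_comm (e : rel 'I_n) i j f : irreflexive e -> symmetric e ->
  markov_random_field nu e -> ~~ e i j ->
  Lop nu i (Lop nu j f) = Lop nu j (Lop nu i f).
Proof.
move=> irr sym mrf eij; have [->//|ij] := eqVneq i j.
rewrite /Lop !PopB (Pop_comm f irr sym mrf ij eij).
by apply/funext => x; ring.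
Qed.

End MarkovRandomField.

Lemma bounded_ratios_gt0 (R : realType) (n : nat) (Sigma : finType) (b : R)
    (nu : config n Sigma -> R) : 0 < b -> is_prob nu ->
  bounded_ratios nu b -> forall x, 0 < nu x.
Proof.
move=> b0 [nu0 nu1] br x.
rewrite lt_def nu0 andbT; apply/eqP => nux0.
have [all_x|] := boolP [forall y, y == x].
  have : \sum_y nu y = 0 by apply: big1 => y _; rewrite (eqP (forallP all_x y)).
  by rewrite nu1 => /eqP; rewrite oner_eq0.
rewrite negb_forall => /existsP[y yx].
have [i yxi] : exists i, y i != x i.
  apply/existsP; rewrite -negb_forall; apply: contra yx => /forallP xy.
  by apply/eqP/ffunP => i; apply/eqP.
(* A zero mass at [x] makes the ratio to any configuration at distance one equal to 0, below the
   lower bound [b^-1 > 0]. *)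
have := br x (upd x i (y i)); rewrite nux0 mul0r => H.
have /H/andP[] : hamming x (upd x i (y i)) = 1%N.
  rewrite -[RHS](cards1 i); apply: eq_card => k; rewrite !inE ffunE.
  by case: (eqVneq k i) => [->|]; rewrite ?eqxx// eq_sym.
by rewrite invr_le0 leNgt b0.
Qed.

(** * The influence inequality *)

Section InfluenceBound.
Variables (R : realType) (n : nat) (Sigma : finType).
Notation T := (config n Sigma).
Variables (nu : T -> R) (e : rel 'I_n) (rho : R).
Hypothesis nu_gt0 : forall x, 0 < nu x.
Hypothesis nu_sum1 : \sum_x nu x = 1.
Hypothesis e_sym : symmetric e.
Hypothesis e_irr : irreflexive e.
Hypothesis mrf : markov_random_field nu e.
Hypothesis rho_gt0 : 0 < rho.
Hypothesis lsi : log_sobolev nu rho.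
Implicit Types (f g h u : T -> R) (x y : T) (i j : 'I_n) (s t : R).

Notation D := ((max_degree e)%:R : R).

Lemma sum_neighbors_le (c : 'I_n -> R) : (forall i, 0 <= c i) ->
  \sum_i \sum_(j | e i j) c i <= D * \sum_i c i.
Proof.
move=> c0; rewrite mulr_sumr; apply: ler_sum => i _.
rewrite (eq_bigl (fun j => j \in neighbors e i)) => [|j]; last by rewrite inE.
rewrite sumr_const -[c i *+ _]mulr_natl ler_wpM2r// ler_nat.
exact: (leq_bigmax i).
Qed.

(** Self-adjointness turns the [(i, j)] term into [<L_j g, L_i v_i> - <L_i g, L_j v_i>], which
    vanishes when the operators commute. For adjacent sites Young's inequality and the contraction
    property bound it, and each site has at most [D] neighbors. *)
Lemma gen_commutator_le g (v : 'I_n -> T -> R) (b : R) : 0 < b ->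
  \sum_i (dot nu (Lop nu i (gen nu g)) (v i) - dot nu (Lop nu i g) (gen nu (v i)))
  <= b * D * dirichlet nu g + D / b * \sum_i dot nu (v i) (v i).
Proof.
move=> b0.
pose a i := dot nu (Lop nu i g) (Lop nu i g).
pose w i := dot nu (v i) (v i).
have a0 i : 0 <= a i by exact: dot_ge0.
have w0 i : 0 <= w i by exact: dot_ge0.
apply: (@le_trans _ _ (\sum_i \sum_(j | e i j)
    (b / 2 * a i + b / 2 * a j + b^-1 * w i))).
  apply: ler_sum => i _.
  have -> : Lop nu i (gen nu g) = fun x => \sum_j Lop nu i (Lop nu j g) x.
    by apply/funext => x; rewrite /gen Lop_sum.
  rewrite dotC !dot_sumr -sumrB [leRHS]big_mkcond; apply: ler_sum => j _.
  rewrite dotC -!Lop_sym//.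
  have [eij|eij] := boolP (e i j); last first.
    by rewrite (Lop_comm _ _ e_irr e_sym mrf eij)// subrr.
  have e0 : 0 <= (2 * b)^-1 by rewrite invr_ge0 mulr_ge0// ltW.
  rewrite !Lop_sym// -[dot nu g (Lop nu j _)]Lop_sym// -[dot nu g (Lop nu i _)]Lop_sym//.
  have := young_dot nu_gt0 (Lop nu j g) (Lop nu i (v i)) b0.
  have := young_dot nu_gt0 (Lop nu i g) (Lop nu j (v i)) b0.
  rewrite !ler_norml => /andP[H _] /andP[_ H'].
  have L1 := ler_wpM2l e0 (Lop_contraction nu_gt0 i (v i)).
  have L2 := ler_wpM2l e0 (Lop_contraction nu_gt0 j (v i)).
  have -> : b^-1 * w i = (2 * b)^-1 * w i + (2 * b)^-1 * w i.
    by field; rewrite gt_eqF.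
  by rewrite /a /w; lra.
under eq_bigr do rewrite !big_split.
rewrite !big_split /=.
have S1 := sum_neighbors_le (fun i => mulr_ge0 (divr_ge0 (ltW b0) (ler0n R 2)) (a0 i)).
have bV0 : 0 <= b^-1 by rewrite invr_ge0 ltW.
have S2 := sum_neighbors_le (fun i => mulr_ge0 bV0 (w0 i)).
(* Symmetry of the graph allows the roles of [i] and [j] to be exchanged, so every term is summed at
   its own site. *)
have S3 : \sum_i \sum_(j | e i j) b / 2 * a j =
    \sum_i \sum_(j | e i j) b / 2 * a i.
  rewrite (exchange_big_dep xpredT)//=; apply: eq_bigr => i _.
  by apply: eq_bigl => j; rewrite e_sym.
rewrite S3 dirichletE.
apply: le_trans (lerD (lerD S1 S1) S2) _.
rewrite -!mulr_sumr le_eqVlt; apply/orP; left; apply/eqP.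
by rewrite /a /w; field; rewrite gt_eqF.
Qed.

Lemma dirichlet_heat_le f (T0 t : R) : 0 <= t <= T0 -> 0 < T0 ->
  (0 < max_degree e)%N ->
  dirichlet nu (heat nu t f) <=
    2 * (\sum_i norm_p nu (1 + expR (- (2 * rho * t))) (Lop nu i f) ^+ 2) +
    4 * (D ^+ 2 * T0) * (dot nu f f - dot nu (heat nu t f) (heat nu t f)).
Proof.
move=> /andP[t0 tT] T0gt0 D0; have Dgt0 : 0 < D by rewrite ltr0n.
pose w i := Lop nu i (heat nu t f).
pose A := dirichlet nu (heat nu t f).
have AE : A = \sum_i dot nu (w i) (w i) by rewrite /A dirichletE.
(* Young's parameter, large enough that the terms in [A] sum to at most [A / 2]. *)
pose b := 4 * D * T0.
have b0 : 0 < b by rewrite !mulr_gt0.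
pose F s := \sum_i dot nu (Lop nu i (heat nu s f)) (heat nu (t - s) (w i)).
(* The two correction terms have derivatives [- b D] times the Dirichlet form of [P_s f] and
   [- (D / b) A], exactly opposite to the two commutator errors, so [G] is nonincreasing. *)
pose G s := F s + (b * D / 2 * dot nu (heat nu s f) (heat nu s f) + (- (D / b * A)) * s).
pose dF s := \sum_i (dot nu (Lop nu i (gen nu (heat nu s f))) (heat nu (t - s) (w i))
  + dot nu (Lop nu i (heat nu s f)) (fun x => - gen nu (heat nu (t - s) (w i)) x)).
pose dG s := dF s + (b * D / 2 * (- (2 * dirichlet nu (heat nu s f))) +
  (- (D / b * A)) * 1).
have GtG0 : G t <= G 0.
  apply: (@is_derive_le0_nincr _ G dG _ _ t0) => s /andP[s0 st].
    have dFs : is_derive s 1 F (dF s).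
      apply: is_derive_sum_fin => i.
      exact: (@is_derive_dot _ _ _ _ (fun r => Lop nu i (heat nu r f))
        (fun r => heat nu (t - r) (w i)) _ _ s
        (fun x => is_derive_Lop nu i x (is_derive_heat nu s f))
        (is_derive_heat_rev nu t s (w i))).
    exact: (is_deriveD dFs (is_deriveD
      (is_deriveZ (b * D / 2) (is_derive_dot_heat nu_gt0 s f))
      (is_deriveZ (- (D / b * A)) (is_derive_id s (1 : R))))).
  rewrite /dG; have -> : dF s = \sum_i
      (dot nu (Lop nu i (gen nu (heat nu s f))) (heat nu (t - s) (w i)) -
       dot nu (Lop nu i (heat nu s f)) (gen nu (heat nu (t - s) (w i)))).
    apply: eq_bigr => i _; congr (_ + _).
    rewrite -[RHS]mulN1r -dotZr; congr dot; apply/funext => x.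
    by rewrite mulN1r.
  have := gen_commutator_le (heat nu s f) (fun i => heat nu (t - s) (w i)) b0.
  have : D / b * \sum_i dot nu (heat nu (t - s) (w i)) (heat nu (t - s) (w i)) <=
      D / b * A.
    rewrite ler_wpM2l ?divr_ge0 ?(ltW b0)// AE; apply: ler_sum => i _.
    rewrite -{3 4}(heat0 nu (w i)); apply: heat_contraction => //.
    by rewrite subr_ge0.
  by rewrite -/A; lra.
have Ft : F t = A.
  by rewrite /F subrr AE; apply: eq_bigr => i _; rewrite heat0.
have F0 : F 0 <=
    \sum_i norm_p nu (1 + expR (- (2 * rho * t))) (Lop nu i f) ^+ 2 + 4^-1 * A.
  rewrite /F subr0 heat0 AE mulr_sumr -big_split; apply: ler_sum => i _ /=.
  (* [P_t] is moved onto [L_i f], where hypercontractivity applies. Young's parameter 2 leaves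
     coefficient 1 on [|P_t L_i f|_2^2] and 1/4 on [|w_i|_2^2]. *)
  rewrite -heat_sym//.
  have := young_dot nu_gt0 (heat nu t (Lop nu i f)) (w i) (ltr0n R 2).
  rewrite ler_norml => /andP[_] /le_trans; apply.
  have := hypercontractive nu_gt0 nu_sum1 (Lop nu i f) rho_gt0 lsi t0.
  rewrite divff// mul1r -natrM; lra.
have Dbt : D / b * t <= 4^-1.
  rewrite /b (_ : _ / _ * _ = 4^-1 * (t / T0)); last first.
    by field; rewrite !gt_eqF.
  by rewrite ler_piMr// ler_pdivrMr// mul1r.
have A0 : 0 <= A by exact: dirichlet_ge0.
(* The initial value and the linear correction each cost at most [A / 4]; absorbing [A / 2] on the
   left doubles the remaining constants. *)
have := ler_wpM2r A0 Dbt.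
move: GtG0; rewrite /G Ft heat0 mulr0 addr0 -/A.
have -> : b * D / 2 = 2 * (D ^+ 2 * T0) by rewrite /b; field.
rewrite [D / b * t * A]mulrAC; move: F0; lra.
Qed.

End InfluenceBound.

(** * Integrating a differential inequality *)

Section Integration.
Variable R : realType.
Implicit Types (F dF H : R -> R) (a t T : R).

Lemma is_derive_le_integral F dF H a T : 0 < T ->
  (forall t, is_derive t 1 F (dF t)) -> continuous dF -> continuous H ->
  (forall t, 0 <= t <= T -> dF t <= H t + a) ->
  F T - F 0 <= \int[lebesgue_measure]_(t in `[0, T]) H t + a * T.
Proof.
move=> T0 derF cdF cH dFH.
have itg (h : R -> R) : continuous h ->
    lebesgue_measure.-integrable `[0, T] (EFin \o h).
  move=> ch; apply: continuous_compact_integrable; first exact: segment_compact.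
  exact: continuous_subspaceT.
have cHa : continuous (fun t => H t + a).
  by move=> t; apply: cvgD; [exact: cH|exact: cvg_cst].
have ftc : \int[lebesgue_measure]_(t in `[0, T]) dF t = F T - F 0.
  rewrite /Rintegral (@continuous_FTC2 _ dF F)//.
  - exact: continuous_subspaceT.
  - split.
    + by move=> t _; case: (derF t).
    + by apply: cvg_at_right_filter; exact: (is_derive_continuous (derF 0)).
    + by apply: cvg_at_left_filter; exact: (is_derive_continuous (derF T)).
  - by move=> t _; rewrite derive1E; case: (derF t).
rewrite -ftc (_ : _ + a * T =
    \int[lebesgue_measure]_(t in `[0, T]) (H t + a)); last first.
  rewrite RintegralD//; last 2 first.
  - exact: itg.
  - by apply: itg => t; exact: cvg_cst.
  by rewrite Rintegral_cst//= lebesgue_measure_itv/= lte_fin T0 /= subr0.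
apply: le_Rintegral => //; try exact: itg.
Qed.

End Integration.

(** * Continuity of the L_p norm in the exponent *)

Section NormContinuity.
Variables (R : realType) (T : finType) (nu : T -> R).
Hypothesis nu_gt0 : forall x, 0 < nu x.

Lemma norm_p_continuous (f : T -> R) (q : R -> R) t :
  (forall s, 0 < q s) -> {for t, continuous q} ->
  {for t, continuous (fun s => norm_p nu (q s) f)}.
Proof.
move=> q0 cq.
have cpow (a : R) : {for t, continuous (fun s => a `^ q s)}.
  (* A zero base is separate because [powR] is then not [expR (q s * ln a)]; positivity of the
     exponent makes the power constantly 0. *)
  have [->|a0] := eqVneq a 0.
    rewrite (_ : (fun s => _) = cst 0); first exact: cvg_cst.
    by apply/funext => s; rewrite powR0 ?gt_eqF.
  rewrite (_ : (fun s => _) = fun s => expR (q s * ln a)); last first.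
    by apply/funext => s; rewrite /powR (negbTE a0).
  apply: (@cvg_comp _ _ _ (fun s => q s * ln a) expR); last exact: continuous_expR.
  exact: cvgMr_tmp.
have [f0|] := boolP [forall x, f x == 0].
  rewrite (_ : (fun s => _) = cst 0); first exact: cvg_cst.
  apply/funext => s; rewrite /norm_p /Ex big1 ?powR0 ?invr_eq0 ?gt_eqF// => x _.
  by rewrite (eqP (forallP f0 x)) normr0 powR0 ?mulr0// gt_eqF.
rewrite negb_forall => /existsP[x0 fx0].
pose S s := Ex nu (fun x => `|f x| `^ q s).
have S0 s : 0 < S s.
  rewrite /S /Ex (bigD1 x0)//= ltr_pwDl ?mulr_gt0 ?powR_gt0 ?normr_gt0//.
  by apply: sumr_ge0 => x _; rewrite mulr_ge0 ?powR_ge0// ltW.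
have cS : {for t, continuous S}.
  by apply: cvg_sum_fin => x; apply: cvgMl_tmp; exact: cpow.
rewrite (_ : (fun s => _) = fun s => expR ((q s)^-1 * ln (S s))); last first.
  by apply/funext => s; rewrite /norm_p /powR -/(S s) gt_eqF.
apply: (@cvg_comp _ _ _ (fun s => (q s)^-1 * ln (S s)) expR);
  last exact: continuous_expR.
apply: cvgM; first by apply: cvgV; rewrite ?gt_eqF.
apply: (@cvg_comp _ _ _ S (@ln R)); first exact: cS.
exact: continuous_ln.
Qed.

End NormContinuity.

(** * Dissipation over a short time interval *)

Section InfluenceInequality.
Variables (R : realType) (n : nat) (Sigma : finType).
Notation T := (config n Sigma).
Variables (nu : T -> R) (e : rel 'I_n) (rho : R).
Hypothesis nu_gt0 : forall x, 0 < nu x.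
Hypothesis nu_sum1 : \sum_x nu x = 1.
Hypothesis e_sym : symmetric e.
Hypothesis e_irr : irreflexive e.
Hypothesis mrf : markov_random_field nu e.
Hypothesis rho_gt0 : 0 < rho.
Hypothesis lsi : log_sobolev nu rho.
Hypothesis deg_gt0 : (0 < max_degree e)%N.

Lemma dirichlet_heat_continuous (f : T -> R) :
  continuous (fun t => dirichlet nu (heat nu t f)).
Proof.
move=> t; rewrite (_ : (fun t => _) = fun t => \sum_i dot nu
    (Lop nu i (heat nu t f)) (Lop nu i (heat nu t f))); last first.
  by apply/funext => s; rewrite dirichletE.
apply: is_derive_continuous; apply: is_derive_sum_fin => i.
have dL x := is_derive_Lop nu i x (is_derive_heat nu t f).
exact: (@is_derive_dot _ _ _ _ (fun s => Lop nu i (heat nu s f))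
  (fun s => Lop nu i (heat nu s f)) _ _ t dL dL).
Qed.

Lemma energy_dissipation_le (f : T -> R) (T0 : R) : 0 < T0 ->
  (max_degree e)%:R * T0 <= 4^-1 ->
  dot nu f f - dot nu (heat nu T0 f) (heat nu T0 f) <=
    8 * \int[lebesgue_measure]_(t in `[0, T0])
      (\sum_(j < n) norm_p nu (1 + expR (- (2 * rho * t))) (Lop nu j f) ^+ 2).
Proof.
move=> T00 DT; set H := fun t : R => \sum_(j < n) _.
set D : R := (max_degree e)%:R in DT.
set G := dot nu f f - _.
pose q t : R := 1 + expR (- (2 * rho * t)).
have cH : continuous H.
  move=> t; apply: cvg_sum_fin => j.
  apply: (@cvg_comp _ _ _ (fun t => norm_p nu (q t) (Lop nu j f)) (fun x => x ^+ 2));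
    last exact: exprn_continuous.
  apply: (@norm_p_continuous _ _ nu nu_gt0 _ q).
    by move=> s; rewrite addr_gt0 ?expR_gt0.
  apply: cvgD; first exact: cvg_cst.
  apply: (@cvg_comp _ _ _ (fun t => - (2 * rho * t)) expR);
    last exact: continuous_expR.
  by apply: cvgN; apply: cvgMl_tmp; exact: cvg_id.
have G0 t : 0 <= t -> dot nu (heat nu t f) (heat nu t f) <= dot nu f f.
  by move=> t0; have := heat_contraction nu_gt0 f t0; rewrite heat0.
have Gt t : t <= T0 ->
    dot nu (heat nu T0 f) (heat nu T0 f) <= dot nu (heat nu t f) (heat nu t f).
  exact: heat_contraction.
have main : G <= \int[lebesgue_measure]_(t in `[0, T0]) (4 * H t) +
    8 * (D ^+ 2 * T0) * G * T0.
  have GE : G = - dot nu (heat nu T0 f) (heat nu T0 f) -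
    - dot nu (heat nu 0 f) (heat nu 0 f) by rewrite heat0 opprK addrC.
  rewrite {1}GE.
  apply: (@is_derive_le_integral R
    (fun t => - dot nu (heat nu t f) (heat nu t f))
    (fun t => - - (2 * dirichlet nu (heat nu t f)))) => //.
  - by move=> t; apply: is_deriveN; exact: is_derive_dot_heat.
  - move=> t; apply: cvgN; apply: cvgN; apply: cvgMl_tmp.
    exact: dirichlet_heat_continuous.
  - by move=> t; apply: cvgMl_tmp; exact: cH.
  move=> t /andP[t0 tT]; rewrite opprK.
  have tT' : 0 <= t <= T0 by rewrite t0.
  have := dirichlet_heat_le nu_gt0 nu_sum1 e_sym e_irr mrf rho_gt0 lsi f tT' T00 deg_gt0.
  rewrite -/(H t) -/D => dH.
  have DT0 : 0 <= D ^+ 2 * T0 by rewrite mulr_ge0 ?sqr_ge0// ltW.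
  (* The energy lost by time [t] is at most the total loss [G], so the error becomes constant in
     [t]. *)
  have := ler_wpM2l DT0 (Gt t tT).
  by rewrite /G; lra.
rewrite RintegralZl// in main; last first.
  apply: continuous_compact_integrable; first exact: segment_compact.
  exact: continuous_subspaceT.
(* The error [8 (D T0)^2 G] is then at most [G / 2]; absorbing it turns the factor 4 in front of the
   integral into 8. *)
have DT2 : (D * T0) ^+ 2 <= 16^-1.
  rewrite (_ : 16^-1 = 4^-1 ^+ 2); last by field.
  by rewrite ler_sqr ?nnegrE// mulr_ge0// ltW.
have GG : 0 <= G by rewrite subr_ge0 G0// ltW.
have := ler_wpM2l GG DT2.
move: main.
rewrite (_ : 8 * (D ^+ 2 * T0) * G * T0 = 8 * (G * (D * T0) ^+ 2)); last by ring.
by move: (\int[_]_(_ in _) _)%R => I; lra.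
Qed.

End InfluenceInequality.

(** * Combining variance decay with the dissipation bound *)

Theorem theorem3p1 (R : realType) :
  exists c c' : R, [/\ 0 < c, 0 < c' &
    forall (n : nat) (Sigma : finType) (b rho : R) (Delta : nat)
      (nu : config n Sigma -> R) (e : rel 'I_n),
    (1 <= n)%N -> 1 <= b -> 0 < rho <= 1 -> (1 <= Delta)%N ->
    is_prob nu ->
    bounded_ratios nu b ->
    log_sobolev nu rho ->
    symmetric e -> irreflexive e -> max_degree e = Delta ->
    markov_random_field nu e ->
    forall (f : config n Sigma -> R) (T : R),
    0 < T <= c / (b ^+ 2 * #|Sigma|%:R ^+ 2 * Delta%:R ^+ 2) ->
    Var nu f <=
      c' * #|Sigma|%:R ^+ 2 * b ^+ 2 / (1 - expR (- (rho * T))) *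
      \int[lebesgue_measure]_(t in `[0, T])
        (\sum_(j < n) (norm_p nu (1 + expR (- (2 * rho * t))) (Lop nu j f)) ^+ 2)].
Proof.
(* With [c = 1/4], the bounds [b, q, Delta >= 1] turn the condition on [T] into [Delta T <= 1/4].
   The constant 8 is that of [energy_dissipation_le], and the factor [q^2 b^2 >= 1] only enlarges
   the right side. *)
exists 4^-1, 8; split; rewrite ?invr_gt0// => n Sigma b rho Delta nu e n0 b1
  /andP[rho0 _] D0 nu_prob br lsi e_sym e_irr eD mrf f T /andP[T0 TD].
have nu_gt0 := bounded_ratios_gt0 (lt_le_trans ltr01 b1) nu_prob br.
have [_ nu1] := nu_prob.
have q1 : (1 : R) <= #|Sigma|%:R.
  rewrite (ler_nat _ 1); apply/card_gt0P.
  (* Total mass 1 forces a configuration to exist, and its value at a site is a symbol. *)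
  have [x] : exists x : config n Sigma, true.
    apply/existsP; rewrite -[X in is_true X]negbK negb_exists; apply/negP => /forallP nox.
    by move: (oner_neq0 R); rewrite -nu1 big1 ?eqxx// => x _; have := nox x.
  by exists (x (Ordinal n0)).
have D1 : (1 : R) <= Delta%:R by rewrite (ler_nat _ 1).
set B := b ^+ 2 * #|Sigma|%:R ^+ 2 in TD.
have B1 : 1 <= B by rewrite /B mulr_ege1// exprn_ege1.
have DT : (max_degree e)%:R * T <= 4^-1.
  rewrite eD; move: TD; rewrite ler_pdivlMr; last first.
    by rewrite mulr_gt0 ?exprn_gt0// ?(lt_le_trans ltr01).
  apply: le_trans; rewrite mulrC ler_pM2l// expr2 mulrA ler_peMl//.
  by rewrite mulr_ege1.
have e1 : expR (- (rho * T)) < 1.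
  by rewrite -expR0 ltr_expR oppr_lt0 mulr_gt0.
set I := \int[_]_(_ in _) _.
have I0 : 0 <= I.
  apply: Rintegral_ge0 => t _; apply: sumr_ge0 => j _; exact: sqr_ge0.
have deg0 : (0 < max_degree e)%N by rewrite eD.
have H := energy_dissipation_le nu_gt0 nu1 e_sym e_irr mrf rho0 lsi deg0 f T0 DT.
have {}H := le_trans (variance_decay nu_gt0 nu1 f lsi rho0 (ltW T0)) H.
rewrite -/I in H.
rewrite -[8 * _ * _]mulrA [_ ^+ 2 * b ^+ 2]mulrC -/B mulrAC ler_pdivlMr ?subr_gt0//.
rewrite mulrC; apply: le_trans H _.
by rewrite -mulrA ler_pM2l// ler_peMl.
Qed.
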